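(* Let $N,M\ge 1$, let $A,B_1,\dots,B_M$ be real symmetric $N\times N$ matrices, and let $\mathcal G$ be the symmetry group of the associated quadratic programming problem (defined in the context). Suppose $B_{\Sigma}:=\sum_{i=1}^M B_i$ is positive definite, and let $S$ be an invertible real $N\times N$ matrix with $B_{\Sigma}=S^TS$. Then $\mathcal G$ is isomorphic to some subgroup of the orthogonal group $O(N)$, and this isomorphism is given by $P\mapsto Q:=SPS^{-1}$; that is, for every $P\in\mathcal G$ the matrix $SPS^{-1}$ is orthogonal, and $P\mapsto SPS^{-1}$ is a group isomorphism from $\mathcal G$ onto a subgroup of $O(N)$.
   Context: The quadratic programming problem associated with $A,B_1,\dots,B_M$ is: maximize $x^TAx$ over $x\in\mathbb R^N$ subject to $x^TB_ix\le 1$ for $i=1,\dots,M$. A symmetry of the problem is an invertible linear change of variables $x\mapsto y=Px$ such that the problem expressed in $y$ has the same form with the same matrix $A$ and the same constraint matrices $B_1,\dots,B_M$ up to renumbering. Equivalently, $\mathcal G$ is the group (under matrix multiplication) of all invertible real $N\times N$ matrices $P$ such that $P^TAP=A$ and there exists an $M\times M$ permutation matrix $L=(L_{ij})$ with $P^TB_iP=\sum_{j=1}^M L_{ij}B_j$ for all $i=1,\dots,M$. $O(N)$ denotes the group of real orthogonal $N\times N$ matrices. *)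

(* Defs.v *)
From HB Require Import structures.
From mathcomp Require Import all_boot all_order all_fingroup all_algebra.
From mathcomp Require Import classical_sets functions reals.

Set Implicit Arguments.
Unset Strict Implicit.
Unset Printing Implicit Defensive.

Import Order.TTheory GRing.Theory Num.Theory.
Local Open Scope ring_scope.

(* The library's 'GL_n[F] requires a finite coefficient ring; this is the
   general linear group over an arbitrary field, as a groupType. *)
Record GLmx (F : fieldType) (n : nat) :=
  GLMx { glval :> 'M[F]_n; glvalP : glval \in unitmx }.

HB.instance Definition _ (F : fieldType) n := [isSub for @glval F n].
HB.instance Definition _ (F : fieldType) n := [Choice of GLmx F n by <:].

Section GLGroup.
Variables (F : fieldType) (n : nat).
Implicit Types P Q T : GLmx F n.

Definition gl1 : GLmx F n := GLMx (unitmx1 F n).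

Fact glmul_subproof P Q : P *m Q \in unitmx.
Proof. by rewrite unitmx_mul !glvalP. Qed.
Definition glmul P Q : GLmx F n := GLMx (glmul_subproof P Q).

Fact glinv_subproof P : invmx P \in unitmx.
Proof. by rewrite unitmx_inv glvalP. Qed.
Definition glinv P : GLmx F n := GLMx (glinv_subproof P).

Fact glmulA : associative glmul.
Proof. by move=> P Q T; apply: val_inj; rewrite /= mulmxA. Qed.
Fact glmul1g : left_id gl1 glmul.
Proof. by move=> P; apply: val_inj; rewrite /= mul1mx. Qed.
Fact glmulg1 : right_id gl1 glmul.
Proof. by move=> P; apply: val_inj; rewrite /= mulmx1. Qed.
Fact glmulVg : left_inverse gl1 glinv glmul.
Proof. by move=> P; apply: val_inj; rewrite /= mulVmx ?glvalP. Qed.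
Fact glmulgV : right_inverse gl1 glinv glmul.
Proof. by move=> P; apply: val_inj; rewrite /= mulmxV ?glvalP. Qed.

HB.instance Definition _ := isGroup.Build (GLmx F n)
  glmulA glmul1g glmulg1 glmulVg glmulgV.

Lemma glval1 : glval (1%g : GLmx F n) = 1%:M. Proof. by []. Qed.
Lemma glvalM P Q : glval (P * Q)%g = P *m Q. Proof. by []. Qed.
Lemma glvalV P : glval (P^-1)%g = invmx P. Proof. by []. Qed.

End GLGroup.

Definition posdefmx (R : realType) (n : nat) (C : 'M[R]_n) : Prop :=
  C \is symmetricmx /\
  (forall x : 'cV[R]_n, x != 0 -> 0 < (x^T *m C *m x) 0 0).

Definition orthogonal_group (R : realType) (n : nat) : {pred GLmx R n} :=
  [pred Q : GLmx R n | Q^T *m Q == 1%:M].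

(* perm_mx s, for s : 'S_M, ranges over the M x M permutation matrices. *)
Definition qp_symmetry_group (R : realType) (N M : nat)
    (A : 'M[R]_N) (B : 'I_M -> 'M[R]_N) : {pred GLmx R N} :=
  [pred P : GLmx R N | (P^T *m A *m P == A) &&
    [exists s : 'S_M, [forall i : 'I_M,
      P^T *m B i *m P == \sum_(j < M) (perm_mx s : 'M[R]_M) i j *: B j]]].

Definition is_group_iso (gT hT : groupType) (G : {pred gT}) (H : {pred hT})
    (f : gT -> hT) : Prop :=
  [/\ group_closed G,
      group_closed H,
      {in G &, {morph f : x y / (x * y)%g}}
    & set_bij [set` G] [set` H] f].

(* Main.v *)
Require Import Defs.
From HB Require Import structures.
From mathcomp Require Import all_boot all_order all_fingroup all_algebra.
From mathcomp Require Import classical_sets functions reals.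

Set Implicit Arguments.
Unset Strict Implicit.
Unset Printing Implicit Defensive.

Import Order.TTheory GRing.Theory Num.Theory.
Local Open Scope ring_scope.

(** A symmetry [P] permutes the constraint matrices, [P^T B_i P = B_(s i)], and
    a sum does not see a permutation of its terms, so [P] preserves the form
    [B_Sigma = S^T S].  In the coordinates [y = S x] this form is the standard
    scalar product and [P] becomes [S P S^-1], which is therefore orthogonal
    ([conj_orthogonal]).  Conjugation by [S] is an injective morphism on the
    whole linear group, so it restricts to an isomorphism from any subgroup
    onto its conjugate ([conj_is_group_iso]); what remains is that the
    symmetries form a subgroup ([qp_symmetry_group_closed]). *)

Lemma sum_perm_mx (R : pzRingType) (V : lmodType R) (m : nat) (s : 'S_m)
    (v : 'I_m -> V) i :
  \sum_(j < m) (perm_mx s : 'M[R]_m) i j *: v j = v (s i).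
Proof.
rewrite (bigD1 (s i)) //= !mxE eqxx scale1r big1 ?addr0 // => j ne_j_si.
by rewrite !mxE eq_sym (negbTE ne_j_si) scale0r.
Qed.

Lemma qp_symmetryP (R : realType) (N M : nat) (A : 'M[R]_N)
    (B : 'I_M -> 'M[R]_N) (P : GLmx R N) :
  reflect (P^T *m A *m P = A /\
           exists s : 'S_M, forall i, P^T *m B i *m P = B (s i))
          (P \in qp_symmetry_group A B).
Proof.
apply: (iffP andP) => -[].
  move=> /eqP PA /existsP[s /forallP sP]; split=> //; exists s => i.
  by rewrite (eqP (sP i)) sum_perm_mx.
move=> PA [s sP]; split; first exact/eqP.
by apply/existsP; exists s; apply/forallP => i; rewrite sP sum_perm_mx.
Qed.

Lemma congr_mxM (R : comPzRingType) (n : nat) (P Q C : 'M[R]_n) :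
  (P *m Q)^T *m C *m (P *m Q) = Q^T *m (P^T *m C *m P) *m Q.
Proof. by rewrite trmx_mul !mulmxA. Qed.

Lemma congr_mxV (F : fieldType) (n : nat) (Q : GLmx F n) (C D : 'M[F]_n) :
  Q^T *m C *m Q = D -> (invmx Q)^T *m D *m invmx Q = C.
Proof.
by move<-; rewrite -congr_mxM mulmxV ?glvalP // trmx1 mul1mx mulmx1.
Qed.

(** The quotient [P / Q] acts on the constraints by [s * t^-1], where [s] and
    [t] are the permutations attached to [P] and [Q]. *)
Lemma qp_symmetry_group_closed (R : realType) (N M : nat) (A : 'M[R]_N)
    (B : 'I_M -> 'M[R]_N) : group_closed (qp_symmetry_group A B).
Proof.
split=> [|P Q].
  apply/qp_symmetryP; rewrite glval1 trmx1 mul1mx mulmx1; split=> //.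
  by exists 1%g => i; rewrite mul1mx mulmx1 perm1.
move=> /qp_symmetryP[PA [s sP]] /qp_symmetryP[QA [t tQ]].
apply/qp_symmetryP; rewrite glvalM glvalV congr_mxM PA; split.
  exact: congr_mxV QA.
exists (s * t^-1)%g => i; rewrite congr_mxM sP permM.
by apply: congr_mxV; rewrite tQ permKV.
Qed.

Lemma qp_symmetry_sum (R : realType) (N M : nat) (A : 'M[R]_N)
    (B : 'I_M -> 'M[R]_N) (P : GLmx R N) : P \in qp_symmetry_group A B ->
  P^T *m (\sum_(i < M) B i) *m P = \sum_(i < M) B i.
Proof.
move=> /qp_symmetryP[_ [s sP]].
rewrite mulmx_sumr mulmx_suml (eq_bigr (fun i => B (s i))) => [|i _] //.
by rewrite [RHS](reindex_inj (@perm_inj _ s)).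
Qed.

(** Congruence by [S^-1] carries the form [S^T S] to the identity, so
    preserving the former is the same as being orthogonal after
    conjugation. *)
Lemma conj_orthogonal (R : realType) (n : nat) (S P : GLmx R n) :
  ((S * P * S^-1)%g \in @orthogonal_group R n) =
  (P^T *m (S^T *m S) *m P == S^T *m S).
Proof.
rewrite inE !glvalM glvalV -[_^T in LHS]mulmx1 !congr_mxM mulmx1.
apply/eqP/eqP => [PS | ->]; last by apply: congr_mxV; rewrite mulmx1.
have := @congr_mxV _ _ (S^-1)%g _ _ PS.
by rewrite glvalV invmxK mulmx1.
Qed.

(** The image of [G] is given as the preimage of [G] under the inverse
    conjugation, which makes it a boolean predicate. *)
Lemma conj_is_group_iso (gT : groupType) (G : {pred gT}) (a : gT) :
  group_closed G ->
  is_group_iso G [pred y | (a^-1 * y * a)%g \in G]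
    (fun x => (a * x * a^-1)%g).
Proof.
move=> clG.
have conjK x : (a^-1 * (a * x * a^-1) * a)%g = x.
  by rewrite !mulgA mulVg mul1g mulgKV.
split=> //; first split.
- by rewrite inE mulg1 mulVg; case: clG.
- move=> x y; rewrite !inE => Gx Gy.
  have [_ /(_ _ _ Gx Gy)] := clG.
  by rewrite !invgM invgK !mulgA mulgK.
- by move=> x y _ _; rewrite !mulgA mulgKV.
split.
- by move=> x /= Gx; rewrite inE conjK.
- by move=> x y _ _ /= eq_xy; rewrite -[x]conjK eq_xy conjK.
- move=> y /= Gy; exists (a^-1 * y * a)%g => //.
  by rewrite !mulgA mulgV mul1g mulgK.
Qed.

Theorem proposition1 (R : realType) (N M : nat) (hN : (0 < N)%N) (hM : (0 < M)%N)
    (A : 'M[R]_N) (B : 'I_M -> 'M[R]_N)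
    (symA : A \is symmetricmx) (symB : forall i, B i \is symmetricmx)
    (posB : posdefmx (\sum_(i < M) B i))
    (S : GLmx R N) (hS : \sum_(i < M) B i = S^T *m S) :
  (forall P : GLmx R N, P \in qp_symmetry_group A B ->
     (S * P * S^-1)%g \in @orthogonal_group R N) /\
  (exists H : {pred GLmx R N},
     [/\ group_closed H,
         {subset H <= @orthogonal_group R N}
       & is_group_iso (qp_symmetry_group A B) H
           (fun P : GLmx R N => (S * P * S^-1)%g)]).
Proof.
have symO P : P \in qp_symmetry_group A B ->
    (S * P * S^-1)%g \in @orthogonal_group R N.
  by move=> /qp_symmetry_sum; rewrite conj_orthogonal hS => ->.
have iso := conj_is_group_iso S (qp_symmetry_group_closed A B).
split=> //; eexists; split; last exact: iso.
  by case: iso.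
by move=> Q /symO; rewrite !mulgA mulgV mul1g mulgK.
Qed.
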